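(* Assume conditions A, D' and E' hold for the semi-Markov processes $\eta^{(\varepsilon)}(t)$, $\varepsilon\in(0,\varepsilon_0]$, together with the paper's standing regularity conditions on the semi-Markov kernels, and let $\delta^*=\min_{i\in\mathbb{X},\,j\in\mathbb{Y}_i}(\delta_{ij}\wedge\dot\delta_{ij})$. Then for every $i\in\mathbb{X}$ the expected return time $E_{ii}(\varepsilon)$ admits a pivotal Laurent expansion with a power-type remainder bound of exponent $\delta^*$: there exist integers $M^-_{ii}\le M^+_{ii}$, reals $B_{ii}[l]$, $M^-_{ii}\le l\le M^+_{ii}$, with $B_{ii}[M^-_{ii}]\ne0$, and constants $G^*_{ii}\in(0,\infty)$, $\dot\varepsilon_{ii}\in(0,\varepsilon_0]$ such that $\big|E_{ii}(\varepsilon)-\sum_{l=M^-_{ii}}^{M^+_{ii}}B_{ii}[l]\varepsilon^l\big|\le G^*_{ii}\varepsilon^{M^+_{ii}+\delta^*}$ for $0<\varepsilon\le\dot\varepsilon_{ii}$.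
   Context: Let $\mathbb{X}=\{1,\dots,N\}$, $0<\varepsilon_0\le1$. For each $\varepsilon\in(0,\varepsilon_0]$, $\eta^{(\varepsilon)}(t)$ is a semi-Markov process on $\mathbb{X}$ with jump times $0=\tau_0<\tau_1<\cdots$, embedded Markov chain $\eta_n=\eta^{(\varepsilon)}(\tau_n)$ and sojourn times $\kappa_{n+1}=\tau_{n+1}-\tau_n$, with semi-Markov transition probabilities $Q^{(\varepsilon)}_{ij}(t)=P(\eta_{n+1}=j,\kappa_{n+1}\le t\mid\eta_n=i)$; $p_{ij}(\varepsilon)=Q^{(\varepsilon)}_{ij}(\infty)$ and $e_{ij}(\varepsilon)=\int_0^\infty t\,Q^{(\varepsilon)}_{ij}(dt)$ (finite). The paper also assumes standing regularity conditions on $Q^{(\varepsilon)}_{ij}$ guaranteeing a well-defined process with finite $e_{ij}$. $E_{ii}(\varepsilon)$ is the expectation of $\tau_{\nu_i}$, where $\nu_i=\min\{n\ge1:\eta_n=i\}$, for the process started at $\eta_0=i$. Condition A: there are nonempty $\mathbb{Y}_i\subseteq\mathbb{X}$ with (a) $p_{ij}(\varepsilon)>0$ for $j\in\mathbb{Y}_i$; (b) $p_{ij}(\varepsilon)=0$ for $j\notin\mathbb{Y}_i$; (c) for all $i,j$ there are $n\ge1$ and $i=l_0,\dots,l_n=j$ with $l_m\in\mathbb{Y}_{l_{m-1}}$. Condition D': for $j\in\mathbb{Y}_i$, $p_{ij}(\varepsilon)=\sum_{l=l^-_{ij}}^{l^+_{ij}}a_{ij}[l]\varepsilon^l+o_{ij}(\varepsilon)$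 with integers $0\le l^-_{ij}\le l^+_{ij}$, $a_{ij}[l^-_{ij}]>0$, $|o_{ij}(\varepsilon)|\le G_{ij}\varepsilon^{l^+_{ij}+\delta_{ij}}$ for $0<\varepsilon\le\varepsilon_{ij}$, $\delta_{ij}\in(0,1]$, $G_{ij}\in(0,\infty)$, $\varepsilon_{ij}\in(0,\varepsilon_0]$. Condition E': for $j\in\mathbb{Y}_i$, $e_{ij}(\varepsilon)=\sum_{l=m^-_{ij}}^{m^+_{ij}}b_{ij}[l]\varepsilon^l+\dot o_{ij}(\varepsilon)$ with integers $m^-_{ij}\le m^+_{ij}$, $b_{ij}[m^-_{ij}]>0$, $|\dot o_{ij}(\varepsilon)|\le\dot G_{ij}\varepsilon^{m^+_{ij}+\dot\delta_{ij}}$ for $0<\varepsilon\le\dot\varepsilon_{ij}$, $\dot\delta_{ij}\in(0,1]$, $\dot G_{ij}\in(0,\infty)$, $\dot\varepsilon_{ij}\in(0,\varepsilon_0]$. *)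

(* Defs.v *)
From HB Require Import structures.
From mathcomp Require Import all_boot all_order all_algebra.
From mathcomp Require Import all_classical all_reals all_analysis.
Set Implicit Arguments.
Unset Strict Implicit.
Unset Printing Implicit Defensive.
Import Order.TTheory GRing.Theory Num.Theory.
Local Open Scope ring_scope.
Local Open Scope classical_set_scope.

Definition trans_prob {R : realType} (Q : {measure set R -> \bar R}) : R :=
  fine (Q setT).

Definition mean_time {R : realType} (Q : {measure set R -> \bar R}) : R :=
  fine (\int[Q]_t (t%:E))%E.

Definition sm_kernel_regular {R : realType} {N : nat}
  (Q : 'I_N -> 'I_N -> {measure set R -> \bar R}) : Prop :=
  (forall i j, Q i j `]-oo, 0%R[ = 0%E) /\
  (forall i j, (Q i j setT < +oo)%E) /\
  (forall i, \sum_(j < N) trans_prob (Q i j) = 1) /\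
  (forall i, \sum_(j < N) fine (Q i j [set 0%R]) < 1) /\
  (forall i j, (Q i j).-integrable setT (fun t => t%:E)).

(* (eta_n, kappa_n) is the embedded chain / sojourn time sequence of a
   semi-Markov process with semi-Markov kernel Q and eta_0 = i:
   P(eta_0 = l_0, kappa_1 <= t_1, eta_1 = l_1, ..., kappa_n <= t_n, eta_n = l_n)
     = [l_0 = i] * prod_{k=1}^n Q_{l_{k-1} l_k}(t_k). *)
Definition is_semi_markov_from {R : realType} {N : nat}
  (Q : 'I_N -> 'I_N -> {measure set R -> \bar R}) (i : 'I_N)
  {d : measure_display} {Omega : measurableType d} (P : probability Omega R)
  (eta : nat -> Omega -> 'I_N) (kappa : nat -> Omega -> R) : Prop :=
  (forall n j, measurable (eta n @^-1` [set j])) /\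
  (forall n, measurable_fun setT (kappa n)) /\
  (forall (n : nat) (l : nat -> 'I_N) (t : nat -> R),
     P [set w | eta 0%N w = l 0%N /\
                forall k, (k < n)%N -> eta k.+1 w = l k.+1 /\ kappa k.+1 w <= t k.+1]
     = ((l 0%N == i)%:R%:E *
        \prod_(k < n) Q (l k) (l k.+1) `]-oo, t k.+1])%E).

Definition return_time {R : realType} {N : nat} {Omega : Type}
  (eta : nat -> Omega -> 'I_N) (kappa : nat -> Omega -> R) (i : 'I_N)
  (w : Omega) : \bar R :=
  match pselect (exists n, [pred m | (0 < m)%N && (eta m w == i)] n) with
  | left h => (\sum_(k < ex_minn h) kappa k.+1 w)%:E
  | right _ => +oo%E
  end.

Definition laurent {R : realType} (B : int -> R) (m1 m2 : int) (e : R) : R :=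
  \sum_(k < (absz (m2 - m1)).+1) B (m1 + k%:Z) * e ^ (m1 + k%:Z).

Definition poly_exp {R : realType} (a : nat -> R) (l1 l2 : nat) (e : R) : R :=
  \sum_(l1 <= l < l2.+1) a l * e ^+ l.

(* Main.v *)
Require Import Defs.
From HB Require Import structures.
From mathcomp Require Import all_boot all_order all_algebra.
From mathcomp Require Import all_classical all_reals all_analysis.
From mathcomp Require Import measurable_realfun ring lra.
Set Implicit Arguments.
Unset Strict Implicit.
Unset Printing Implicit Defensive.
Import Order.TTheory GRing.Theory Num.Theory.
Import numFieldNormedType.Exports.
Local Open Scope ring_scope.
Local Open Scope classical_set_scope.

(** A function [f] is pivotal when [f e = c e^m (1 + O(e^d))] with [c > 0]. As
    all leading coefficients are positive, no cancellation can occur and, for a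
    fixed [0 < d <= 1], pivotal functions are closed under sums, products and
    quotients. The expected hitting times [x] of [i] solve
    [sum_j p_kj (x_k - x_j) = e_k] for [k != i], with [x_i = 0]. Eliminating one
    state [s] after the other replaces [p_kj] by [p_kj + p_ks p_sj / R_s], where
    the exit weight [R_s = sum_(j != s) p_sj] stands for [1 - p_ss]; only sums,
    products and quotients are involved, so every [x_k] is pivotal or zero, and
    so is [E_ii = e_i + sum_(j != i) p_ij x_j]. The numbers [M^-] and [M^+] being
    existentially quantified, the leading term with its remainder suffices, and
    [M^+ = M^-].

    On the probabilistic side, [E_ii = sum_n E(kappa_{n+1} 1_{nu > n})], and with
    [u_n(k) = P(nu > n, eta_n = k)] the Markov property turns the [n]-th term into
    [sum_k u_n(k) e_k = sum_k u_n(k) x_k - sum_k u_{n+1}(k) x_k]. The telescoping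
    series converges to [x_i] because [u_n] tends to [0], which follows by solving
    the same system with right-hand side [1]. *)

(** * Functions with a positive leading power *)

Section PowerRate.
Variables (R : realType) (d : R).
Hypotheses (d_gt0 : 0 < d) (d_le1 : d <= 1).
Implicit Types (F G f g : R -> R) (c : R) (m : int).

Definition cvg_rate F c :=
  exists C, \forall e \near 0^'+, `|F e - c| <= C * e `^ d.

Lemma near0_lt1 : \forall e \near (0 : R)^'+, 0 < e < 1.
Proof.
near=> e; apply/andP; split; near: e; first exact: nbhs_right_gt.
exact: nbhs_right_lt.
Unshelve. all: by end_near. Qed.

Lemma near_exists_radius (P : R -> Prop) (r : R) : 0 < r ->
  (\forall e \near 0^'+, P e) ->
  exists r', 0 < r' <= r /\ forall e, 0 < e <= r' -> P e.
Proof.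
move=> r0 [s /= s0 sP]; exists (Num.min r (s / 2)).
have s20 : 0 < s / 2 by rewrite divr_gt0.
rewrite lt_min r0 s20 ge_min lexx; split => // e /andP[e0].
rewrite le_min => /andP[_ es]; apply: sP => //=.
by rewrite sub0r normrN gtr0_norm//; lra.
Qed.

Lemma cvg_rate_near F G c : (\forall e \near 0^'+, F e = G e) ->
  cvg_rate F c -> cvg_rate G c.
Proof.
move=> FG [C HC]; exists C; near=> e.
have <- : F e = G e by near: e.
by near: e.
Unshelve. all: by end_near. Qed.

Lemma cvg_rate_cst c : cvg_rate (fun=> c) c.
Proof. by exists 0; near=> e; rewrite subrr normr0 mul0r. 
Unshelve. all: by end_near. Qed.

Lemma cvg_rateD F G c c' : cvg_rate F c -> cvg_rate G c' ->
  cvg_rate (F \+ G) (c + c').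
Proof.
move=> [C HC] [C' HC']; exists (C + C'); near=> e.
have h1 : `|F e - c| <= C * e `^ d by near: e.
have h2 : `|G e - c'| <= C' * e `^ d by near: e.
rewrite mulrDl /= opprD addrACA.
exact: le_trans (ler_normD _ _) (lerD h1 h2).
Unshelve. all: by end_near. Qed.

Lemma cvg_rate_bounded F c : cvg_rate F c ->
  exists C, \forall e \near 0^'+, `|F e| <= C.
Proof.
move=> [C HC]; exists (`|C| + `|c|); near=> e.
have h1 : `|F e - c| <= C * e `^ d by near: e.
have /andP[e0 e1] : 0 < e < 1 by near: e; exact: near0_lt1.
have ed1 : e `^ d <= 1.
  by rewrite -[leRHS](powRr0 e) ger_powR// ?e0 ?(ltW e1) ?(ltW d_gt0).
have h3 : C * e `^ d <= `|C|.
  apply: le_trans (ler_norm _) _; rewrite normrM ler_piMr//.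
  by rewrite ger0_norm// powR_ge0.
have := ler_normD (F e - c) c; rewrite subrK.
move: (F e - c) h1 => z h1; lra.
Unshelve. all: by end_near. Qed.

Lemma cvg_rateM F G c c' : cvg_rate F c -> cvg_rate G c' ->
  cvg_rate (F \* G) (c * c').
Proof.
move=> HF [C' HG]; have [B HB] := cvg_rate_bounded HF; case: HF => C HF.
exists (B * C' + `|c'| * C); near=> e.
have h1 : `|F e - c| <= C * e `^ d by near: e.
have h2 : `|G e - c'| <= C' * e `^ d by near: e.
have h3 : `|F e| <= B by near: e.
rewrite /= (_ : F e * G e - c * c' = F e * (G e - c') + c' * (F e - c)); last ring.
apply: (le_trans (ler_normD _ _)); rewrite !normrM mulrDl -!mulrA.
by apply: lerD; apply: ler_pM.
Unshelve. all: by end_near. Qed.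

Lemma cvg_rate_cvg F c : cvg_rate F c -> F e @[e --> 0^'+] --> c.
Proof.
move=> [C HC]; apply/cvgrPdist_le => /= s s0.
have : (C * e `^ d) @[e --> 0^'+] --> C * 0.
  by apply: cvgM; [exact: cvg_cst|exact: powR_cvg0].
rewrite mulr0 => /cvgr0_norm_le/(_ s s0) Cs.
near=> e; rewrite distrC.
have h1 : `|F e - c| <= C * e `^ d by near: e.
have h2 : `|C * e `^ d| <= s by near: e.
exact: le_trans h1 (le_trans (ler_norm _) h2).
Unshelve. all: by end_near. Qed.

(** Near $0$ one has $F > c/2$, so $|1/F - 1/c| = |c - F|/(Fc)$ is at most $2/c^2$ times the error
    of $F$. *)
Lemma cvg_rateV F c : 0 < c -> cvg_rate F c -> cvg_rate (fun e => (F e)^-1) c^-1.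
Proof.
move=> c0 HF; have /cvgr_gt/(_ (c / 2)) Fc := cvg_rate_cvg HF.
case: HF => C HF; exists (2 / (c * c) * C); near=> e.
have h1 : `|F e - c| <= C * e `^ d by near: e.
have h2 : c / 2 < F e by near: e; apply: Fc; lra.
have c20 : 0 < c / 2 by lra.
have Fe0 : 0 < F e by lra.
rewrite (_ : (F e)^-1 - c^-1 = (F e * c)^-1 * (c - F e)); last first.
  by field; rewrite !gt_eqF.
rewrite normrM distrC -[leRHS]mulrA; apply: ler_pM => //.
rewrite gtr0_norm ?invr_gt0 ?mulr_gt0//.
rewrite (_ : 2 / (c * c) = (c / 2 * c)^-1); last by field; rewrite gt_eqF.
rewrite lef_pV2 ?posrE ?mulr_gt0//.
by rewrite ler_pM2r // ltW.
Unshelve. all: by end_near. Qed.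

(** Here $d \le 1$ enters: $e^{n+1} \le e^d$ for $0 < e < 1$. *)
Lemma cvg_rate_exprS n : cvg_rate (fun e => e ^+ n.+1) 0.
Proof.
exists 1; near=> e; rewrite subr0 mul1r.
have /andP[e0 e1] : 0 < e < 1 by near: e; exact: near0_lt1.
rewrite gtr0_norm ?exprn_gt0// -powR_mulrn ?(ltW e0)//.
rewrite ger_powR// ?e0 ?(ltW e1)//; apply: le_trans d_le1 _.
by rewrite ler1n.
Unshelve. all: by end_near. Qed.

(** The exponent [m] may be negative. Normalising by $e^{-m}$ reduces sums, products and inverses to
    the rules for [cvg_rate]. *)
Definition pivotal f :=
  exists (m : int) c, 0 < c /\ cvg_rate (fun e => f e * e ^ (- m)) c.

Lemma pivotal_near f g : (\forall e \near 0^'+, f e = g e) ->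
  pivotal f -> pivotal g.
Proof.
move=> fg [m [c [c0 H]]]; exists m, c; split=> //.
apply: cvg_rate_near H; near=> e.
by have -> : f e = g e by near: e.
Unshelve. all: by end_near. Qed.

Lemma pivotal_gt0 f : pivotal f -> \forall e \near 0^'+, 0 < f e.
Proof.
move=> [m [c [c0 /cvg_rate_cvg/cvgr_gt/(_ 0 c0) H]]]; near=> e.
have e0 : 0 < e by near: e; exact: nbhs_right_gt.
have : 0 < f e * e ^ (- m) by near: e.
by rewrite pmulr_lgt0// exprz_gt0.
Unshelve. all: by end_near. Qed.

Lemma pivotal_cst c : 0 < c -> pivotal (fun=> c).
Proof.
move=> c0; exists 0, c; split=> //.
apply: cvg_rate_near (cvg_rate_cst c).
by near=> e; rewrite oppr0 expr0z mulr1.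
Unshelve. all: by end_near. Qed.

Lemma pivotalM f g : pivotal f -> pivotal g -> pivotal (f \* g).
Proof.
move=> [m [c [c0 Hf]]] [n [c' [c'0 Hg]]]; exists (m + n), (c * c').
rewrite mulr_gt0//; split=> //.
apply: cvg_rate_near (cvg_rateM Hf Hg); near=> e => /=.
have e0 : 0 < e by near: e; exact: nbhs_right_gt.
by rewrite opprD expfzDr ?gt_eqF//; ring.
Unshelve. all: by end_near. Qed.

Lemma pivotalV f : pivotal f -> pivotal (fun e => (f e)^-1).
Proof.
move=> [m [c [c0 Hf]]]; exists (- m), c^-1; rewrite invr_gt0; split=> //.
apply: cvg_rate_near (cvg_rateV c0 Hf); near=> e => /=.
by rewrite invfM invr_expz.
Unshelve. all: by end_near. Qed.

Lemma pivotalD f g : pivotal f -> pivotal g -> pivotal (f \+ g).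
Proof.
suff main (m n : int) c c' : (m <= n)%R -> 0 < c -> 0 < c' ->
    forall f g, cvg_rate (fun e => f e * e ^ (- m)) c ->
    cvg_rate (fun e => g e * e ^ (- n)) c' -> pivotal (f \+ g).
  move=> [m [c [c0 Hf]]] [n [c' [c'0 Hg]]]; have [mn|/ltW nm] := leP m n.
    exact: (main m n c c').
  apply: (@pivotal_near (g \+ f)); last exact: (main n m c' c).
  by near=> e; rewrite /= addrC.
move=> mn c0 c'0 {}f {}g Hf Hg.
have [k nE] : exists k : nat, n = m + k%:Z.
  by exists (absz (n - m)); rewrite gez0_abs ?subr_ge0//; ring.
(* Divided by $e^m$, the term of higher order keeps a factor $e^k$, whose limit [t] is $1$ if $k =
   0$ and $0$ otherwise. *)
have Hk : exists2 t, 0 <= t & cvg_rate (fun e => e ^+ k) t.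
  case: k {nE} => [|k]; last by exists 0 => //; exact: cvg_rate_exprS.
  by exists 1 => //; exact: cvg_rate_cst.
have [t t0 {}Hk] := Hk; exists m, (c + c' * t); split.
  by rewrite ltr_wpDr// mulr_ge0// ltW.
apply: cvg_rate_near (cvg_rateD Hf (cvg_rateM Hg Hk)); near=> e => /=.
have e0 : 0 < e by near: e; exact: nbhs_right_gt.
rewrite mulrDl nE opprD expfzDr ?gt_eqF// -exprnN.
by field; rewrite expf_neq0 ?gt_eqF.
Unshelve. all: by end_near. Qed.

(** Forbidden transitions vanish, so zero has to be allowed; sums and products stay in the class,
    inverses do not. *)
Definition pivotal0 f := (\forall e \near 0^'+, f e = 0) \/ pivotal f.

Lemma pivotal0_ge0 f : pivotal0 f -> \forall e \near 0^'+, 0 <= f e.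
Proof.
case=> [f0|/pivotal_gt0]; first by apply: filterS f0 => e ->.
by apply: filterS => e /ltW.
Unshelve. all: by end_near. Qed.

Lemma pivotal_addl f g : pivotal f -> pivotal0 g -> pivotal (f \+ g).
Proof.
move=> pf [g0|pg]; last exact: pivotalD.
by apply: pivotal_near pf; apply: filterS g0 => e /= ->; rewrite addr0.
Unshelve. all: by end_near. Qed.

Lemma pivotal_addr f g : pivotal0 f -> pivotal g -> pivotal (f \+ g).
Proof.
move=> pf pg; apply: pivotal_near (pivotal_addl pg pf).
by near=> e; rewrite /= addrC.
Unshelve. all: by end_near. Qed.

Lemma pivotal0D f g : pivotal0 f -> pivotal0 g -> pivotal0 (f \+ g).
Proof.
move=> [f0|pf] pg; last by right; exact: pivotal_addl.
case: pg => [g0|pg]; last by right; apply: pivotal_addr => //; left.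
left; near=> e => /=.
have -> : f e = 0 by near: e.
have -> : g e = 0 by near: e.
by rewrite addr0.
Unshelve. all: by end_near. Qed.

Lemma pivotal0M f g : pivotal0 f -> pivotal0 g -> pivotal0 (f \* g).
Proof.
move=> [f0|pf] pg; first by left; apply: filterS f0 => e /= ->; rewrite mul0r.
case: pg => [g0|pg]; first by left; apply: filterS g0 => e /= ->; rewrite mulr0.
by right; exact: pivotalM.
Unshelve. all: by end_near. Qed.

Lemma pivotal00 : pivotal0 (fun=> 0).
Proof. by left; near=> e. Unshelve. all: by end_near. Qed.

Lemma pivotal0_sum (I : Type) (s : seq I) (p : pred I) (f : I -> R -> R) :
  (forall i, p i -> pivotal0 (f i)) ->
  pivotal0 (fun e => \sum_(i <- s | p i) f i e).
Proof.
move=> pf; elim: s => [|i s IH].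
  by under eq_fun do rewrite big_nil; exact: pivotal00.
under eq_fun do rewrite big_cons.
by case pi: (p i) => //; exact: (pivotal0D (pf _ pi) IH).
Qed.

Lemma pivotal_sum (I : finType) (p : pred I) (f : I -> R -> R) (j : I) :
  (forall i, p i -> pivotal0 (f i)) -> p j -> pivotal (f j) ->
  pivotal (fun e => \sum_(i | p i) f i e).
Proof.
move=> pf pj fj; under eq_fun do rewrite (bigD1 j)//=.
apply: (pivotal_addl fj); apply: pivotal0_sum => i /andP[pi _]; exact: pf.
Qed.

End PowerRate.

(** * Elimination of states *)

Section Elimination.
Variables (R : realType) (d : R).
Hypotheses (d_gt0 : 0 < d) (d_le1 : d <= 1).

(** Reachability of the complement of [S] through pivotal entries, stated by exits from subsets so
    that it passes to the reduced system. *)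
Definition escapes (I : finType) (S : {set I}) (r : I -> I -> R -> R) :=
  forall T : {set I}, T != finset.set0 -> T \subset S ->
    exists k j, [/\ k \in T, j \notin T & pivotal d (r k j)].

(** Induction on the size of [S]. In difference form the diagonal entries drop out, so the
    subtraction $1 - p_{ss}$ never appears. *)
Lemma Poisson_elimination (I : finType) n (S : {set I})
    (r : I -> I -> R -> R) (b : I -> R -> R) : #|S| = n ->
  (forall k j, pivotal0 d (r k j)) -> (forall k, pivotal0 d (b k)) ->
  escapes S r ->
  exists x : I -> R -> R, [/\ forall k, pivotal0 d (x k),
    forall k e, k \notin S -> x k e = 0 &
    \forall e \near 0^'+, forall k, k \in S ->
      \sum_j r k j e * (x k e - x j e) = b k e].
Proof.
elim: n S r b => [|n IH] S r b cardS r_piv b_piv S_esc.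
  exists (fun _ _ => 0); split=> //; first by move=> k; exact: pivotal00.
  near=> e => k; rewrite (cards0_eq cardS) inE.
  by [].
have /card_gt0P[s sS] : (0 < #|S|)%N by rewrite cardS.
pose Rs e := \sum_(j | j != s) r s j e.
have Rs_piv : pivotal d Rs.
  (* The exit from $\{s\}$ supplies a pivotal term of [Rs], which may then be inverted. *)
  have [||k [j []]] := S_esc [set s]%SET.
  - by apply/set0Pn; exists s; rewrite inE.
  - by rewrite finset.sub1set.
  rewrite !inE => /eqP -> js rsj.
  by exact: (pivotal_sum d_gt0 d_le1 (f := r s) (fun i _ => r_piv s i) js rsj).
have Rs0_piv : pivotal0 d (fun e => (Rs e)^-1) by right; exact: pivotalV.
(* A jump to [s] is redirected to the state entered on leaving [s], with weights $r_{sj}/R_s$; the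
   column of [s] becomes zero. *)
pose r' k j e := if j == s then 0 else r k j e + r k s e * (r s j e * (Rs e)^-1).
pose b' k e := b k e + r k s e * (b s e * (Rs e)^-1).
have via_piv k (g : R -> R) : pivotal0 d g ->
    pivotal0 d (fun e => r k s e * (g e * (Rs e)^-1)).
  move=> gp; apply: (pivotal0M d_gt0 (r_piv k s)).
  exact: (pivotal0M d_gt0 gp Rs0_piv).
have [|k j|k|T T0 TS|x' [x'_piv x'0 x'E]] := IH (S :\ s)%SET r' b'.
- by move: cardS; rewrite (cardsD1 s) sS => -[].
- rewrite /r'; case: (j == s); first exact: pivotal00.
  exact: (pivotal0D d_gt0 d_le1 (r_piv k j) (via_piv k _ (r_piv s j))).
- exact: (pivotal0D d_gt0 d_le1 (b_piv k) (via_piv k _ (b_piv s))).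
- have sT : s \notin T by apply/negP => /(fintype.subsetP TS); rewrite !inE eqxx.
  have TS' : T \subset S by apply: fintype.subset_trans TS (subD1set _ _).
  have direct k j : k \in T -> j \notin T -> j != s -> pivotal d (r k j) ->
      exists k j, [/\ k \in T, j \notin T & pivotal d (r' k j)].
    move=> kT jT js rkj; exists k, j; split => //.
    rewrite /r' (negbTE js).
    exact: (pivotal_addl d_gt0 d_le1 rkj (via_piv k _ (r_piv s j))).
  have [k [j [kT jT rkj]]] := S_esc T T0 TS'.
  have [js|js] := eqVneq j s; last exact: direct rkj.
  (* [s] is reached from [T]: any edge leaving [s |: T] gives an edge leaving
     [T] in the reduced graph, possibly through [s]. *)
  have [||k' [j' []]] := S_esc (s |: T)%SET.
  - by apply/set0Pn; exists s; rewrite !inE eqxx.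
  - by rewrite finset.subUset finset.sub1set sS.
  rewrite !inE negb_or => /orP[/eqP ->|k'T] /andP[j's j'T] rk'j'; last first.
    exact: direct rk'j'.
  exists k, j'; split => //; rewrite /r' (negbTE j's).
  apply: (pivotal_addr d_gt0 d_le1 (r_piv k j')).
  rewrite js in rkj; apply: (pivotalM d_gt0 rkj).
  by apply: (pivotalM d_gt0 rk'j'); exact: pivotalV.
pose x k e := if k == s then (b s e + \sum_(j | j != s) r s j e * x' j e) * (Rs e)^-1
              else x' k e.
exists x; split.
- move=> k; rewrite /x; case: (k == s) => //.
  apply: (pivotal0M d_gt0) Rs0_piv.
  apply: (pivotal0D d_gt0 d_le1 (b_piv s)).
  by apply: (pivotal0_sum d_gt0 d_le1) => j _; exact: (pivotal0M d_gt0 (r_piv s j) (x'_piv j)).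
- move=> k e kS; rewrite /x; case: eqP => [ks|_]; first by rewrite ks sS in kS.
  by apply: x'0; rewrite !inE (negbTE kS) andbF.
near=> e => k kS.
have Rs_gt0 : 0 < Rs e by near: e; exact: pivotal_gt0 Rs_piv.
have x'eE : forall k, k \in (S :\ s)%SET ->
    \sum_j r' k j e * (x' k e - x' j e) = b' k e by near: e.
have xs j : j != s -> x j e = x' j e by rewrite /x => /negbTE ->.
(* The equation of row [s] with a free value [u]: $u = x_s$ gives row [s] itself, $u = x_k$ turns
   the reduced row [k] into the original one. *)
have Rs_x (u : R) : \sum_(j | j != s) r s j e * (u - x j e) = Rs e * (u - x s e) + b s e.
  under eq_bigr => j js do rewrite xs// mulrBr.
  rewrite sumrB -mulr_suml -/(Rs e) /x eqxx.
  by field; rewrite gt_eqF.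
have [->|ks] := eqVneq k s.
  by rewrite (bigD1 s)//= subrr mulr0 add0r Rs_x subrr mulr0 add0r.
have := x'eE k; rewrite !inE ks kS => /(_ isT).
rewrite (bigD1 s)//= {1}/r' eqxx mul0r add0r /b'.
under eq_bigr => j js.
  rewrite /r' (negbTE js) -!xs// mulrDl -2!mulrA [(Rs e)^-1 * _]mulrC [r s j e * _]mulrA. over.
rewrite big_split/= -mulr_sumr -mulr_suml Rs_x => E; rewrite (bigD1 s)//=.
apply: (addIr (r k s e * (b s e * (Rs e)^-1))); rewrite -E.
by field; rewrite gt_eqF.
Unshelve. all: by end_near. Qed.

End Elimination.

(** * Laurent expansions and the hitting system *)

Section Expansions.
Variables (R : realType) (d : R).
Hypotheses (d_gt0 : 0 < d) (d_le1 : d <= 1).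

Lemma cvg_rate_sum0 n (F : 'I_n -> R -> R) :
  (forall k, cvg_rate d (F k) 0) -> cvg_rate d (fun e => \sum_(k < n) F k e) 0.
Proof.
elim: n F => [F _|n IH F HF].
  by under eq_fun do rewrite big_ord0; exact: cvg_rate_cst.
under eq_fun do rewrite big_ord_recl.
have := cvg_rateD (HF ord0) (IH (fun k => F (lift ord0 k)) (fun k => HF _)).
by rewrite addr0.
Qed.

Lemma cvg_rate_laurent (B : int -> R) (m1 m2 : int) :
  cvg_rate d (fun e => laurent B m1 m2 e * e ^ (- m1)) (B m1).
Proof.
have H0 : cvg_rate d (fun e => \sum_(k < absz (m2 - m1)) B (m1 + k.+1%:Z) * e ^+ k.+1) 0.
  apply: cvg_rate_sum0 => k; rewrite -(mulr0 (B (m1 + k.+1%:Z))).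
  apply: (cvg_rateM d_gt0 (cvg_rate_cst d _)); exact: cvg_rate_exprS.
have := cvg_rateD (cvg_rate_cst d (B m1)) H0; rewrite addr0.
apply: cvg_rate_near; near=> e.
have e0 : 0 < e by near: e; exact: nbhs_right_gt.
have eN0 : e != 0 by rewrite gt_eqF.
rewrite /laurent big_ord_recl /= addr0 mulrDl -mulrA -expfzDr// subrr expr0z mulr1.
congr (_ + _); rewrite mulr_suml; apply: eq_bigr => k _.
rewrite /bump add1n -mulrA -expfzDr//; congr (_ * _).
by rewrite addrAC subrr add0r.
Unshelve. all: by end_near. Qed.

(** Divided by $e^{m_1}$, the remainder is at most $C e^{m_2 - m_1 + d'} \le C e^d$ for $e \le 1$,
    and the leading coefficient is the limit. *)
Lemma pivotal_laurent (f : R -> R) (B : int -> R) (m1 m2 : int) (C d' r : R) :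
  m1 <= m2 -> 0 < B m1 -> d <= d' -> 0 < C -> 0 < r ->
  (forall e, 0 < e <= r -> `|f e - laurent B m1 m2 e| <= C * e `^ (m2%:~R + d')) ->
  pivotal d f.
Proof.
move=> m12 B0 dd' C0 r0 fB; exists m1, (B m1); split=> //.
have H0 : cvg_rate d (fun e => (f e - laurent B m1 m2 e) * e ^ (- m1)) 0.
  exists C; near=> e.
  have e0 : 0 < e by near: e; exact: nbhs_right_gt.
  have e1 : e <= 1 by near: e; apply: nbhs_right_le.
  have er : e <= r by near: e; apply: nbhs_right_le.
  rewrite subr0 normrM (@gtr0_norm _ (_ ^ _)) ?exprz_gt0//.
  have h : `|f e - laurent B m1 m2 e| <= C * e `^ (m2%:~R + d').
    by apply: fB; rewrite e0.
  apply: (@le_trans _ _ (C * e `^ (m2%:~R + d') * e ^ (- m1))).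
    by apply: ler_wpM2r h; rewrite exprz_ge0// ltW.
  rewrite -mulrA ler_pM2l// -powR_intmul ?(ltW e0)// -powRD; last first.
    by rewrite (gt_eqF e0) implybT.
  rewrite ger_powR ?e0// addrAC -intrD.
  by rewrite (le_trans dd')// lerDr ler0z subr_ge0.
have := cvg_rateD H0 (cvg_rate_laurent B m1 m2); rewrite add0r.
by apply: cvg_rate_near; near=> e => /=; ring.
Unshelve. all: by end_near. Qed.

Lemma poly_exp_laurent (a : nat -> R) (l1 l2 : nat) (e : R) : (l1 <= l2)%N ->
  poly_exp a l1 l2 e = laurent (a \o absz) l1 l2 e.
Proof.
move=> l12; rewrite /poly_exp /laurent -{1}(add0n l1) big_addn big_mkord.
rewrite subzn// subSn//; apply: eq_bigr => k _.
by rewrite -PoszD /= -exprnP addnC.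
Qed.

Lemma pivotal_laurent_expansion (f : R -> R) (r : R) : 0 < r -> pivotal d f ->
  exists (m : int) (B : int -> R) (C r' : R),
    [/\ B m != 0, 0 < C, 0 < r' <= r & forall e, 0 < e <= r' ->
        `|f e - laurent B m m e| <= C * e `^ (m%:~R + d)].
Proof.
move=> r0 [m [c [c0 [C HC]]]].
have [r' [r'r Hr']] := near_exists_radius r0 HC.
(* The expansion has a single term; [|C| + 1] makes the constant strictly positive. *)
exists m, (fun=> c), (`|C| + 1), r'; split=> //; first by rewrite gt_eqF.
move=> e er; have := Hr' e er; case/andP: er => e0 _.
have em0 : 0 < e ^ m by rewrite exprz_gt0.
rewrite /laurent subrr big_ord1 addr0 => h.
have -> : f e - c * e ^ m = (f e * e ^ (- m) - c) * e ^ m.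
  by rewrite mulrBl -mulrA -expfzDr ?gt_eqF// addNr expr0z mulr1.
rewrite normrM (gtr0_norm em0) powRD ?(gt_eqF e0) ?implybT// powR_intmul ?(ltW e0)//.
rewrite [X in _ <= _ * X]mulrC mulrA ler_pM2r//; apply: le_trans h _.
apply: ler_wpM2r; first exact: powR_ge0.
by rewrite (le_trans (ler_norm _))// lerDl.
Qed.

(** Elimination solves the system off [i] with $x_i = 0$. Putting this solution into the right-hand
    side gives [z], equal to [x] off [i] and to the return value at [i]; the latter is pivotal since
    [b i] is. *)
Lemma pivotal_hitting_system (I : finType) (Y : I -> {set I}) (i : I)
    (p : I -> I -> R -> R) (b : I -> R -> R) :
  (forall k j, pivotal0 d (p k j)) ->
  (forall k j, j \in Y k -> pivotal d (p k j)) ->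
  (forall k, exists n (l : nat -> I), l 0%N = k /\ l n = i /\
    forall m, (m < n)%N -> l m.+1 \in Y (l m)) ->
  (\forall e \near 0^'+, forall k, \sum_j p k j e = 1) ->
  (forall k, pivotal0 d (b k)) -> pivotal d (b i) ->
  exists x : I -> R -> R, pivotal d (x i) /\
    \forall e \near 0^'+, forall k,
      0 <= x k e /\ x k e = b k e + \sum_(j | j != i) p k j e * x j e.
Proof.
move=> p0 pY access p1 b0 bi.
have esc : escapes d [set~ i]%SET p.
  move=> T /set0Pn[k kT] TS; have [n [l [l0 [ln lY]]]] := access k.
  have iT : i \notin T by apply/negP => /(fintype.subsetP TS); rewrite !inE eqxx.
  have ex : exists m, l m \notin T by exists n; rewrite ln.
  (* The first vertex of the path to [i] lying outside [T] is entered by an edge leaving [T]. *)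
  case: (ex_minnP ex) => -[|m] lmT lmin; first by rewrite l0 kT in lmT.
  have mn : (m < n)%N by apply: lmin; rewrite ln.
  exists (l m), (l m.+1); split=> //; last by apply: pY; exact: lY.
  by apply: contraT => /lmin; rewrite ltnn.
have [x [x_piv x0 xE]] := Poisson_elimination d_gt0 d_le1 erefl p0 b0 esc.
pose z k e := b k e + \sum_(j | j != i) p k j e * x j e.
have zx_piv k : pivotal0 d (fun e => \sum_(j | j != i) p k j e * x j e).
  apply: (pivotal0_sum d_gt0 d_le1) => j _.
  exact: (pivotal0M d_gt0 (p0 k j) (x_piv j)).
have z_ge0 : \forall e \near 0^'+, forall k, 0 <= z k e.
  apply: filter_forall => k; apply: (pivotal0_ge0 d_gt0 (f := z k)).
  exact: (pivotal0D d_gt0 d_le1 (b0 k) (zx_piv k)).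
exists z; split; first exact: (pivotal_addl d_gt0 d_le1 bi (zx_piv i)).
near=> e => k.
have pe1 : forall k, \sum_j p k j e = 1 by near: e.
have xe k' : k' \in [set~ i]%SET -> \sum_j p k' j e * (x k' e - x j e) = b k' e.
  by move: k'; near: e.
split; first by move: k; near: e.
rewrite {1}/z; congr (_ + _); apply: eq_bigr => j ji; congr (_ * _).
(* Row sums equal to one turn the difference form into the fixed-point form. *)
rewrite /z -xe ?inE//; under eq_bigr do rewrite mulrBr.
rewrite sumrB -mulr_suml pe1 mul1r [X in _ - X](bigD1 i)//= (x0 i e) ?inE ?eqxx//.
by rewrite mulr0 add0r subrK.
Unshelve. all: by end_near. Qed.

End Expansions.

(** * Laws on a restricted event *)

Section MeasureComplements.

Lemma measure_fin_partition d (T : measurableType d) (R : realType)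
    (mu : {measure set T -> \bar R}) (I : finType) (X : T -> I) (A : set T) :
  measurable A -> (forall s, measurable (X @^-1` [set s])) ->
  mu A = (\sum_s mu (A `&` X @^-1` [set s]))%E.
Proof.
move=> mA mX.
have AE : A = \bigcup_(s in [set: I]) (A `&` X @^-1` [set s]).
  apply/seteqP; split => w; last by case=> s _ [].
  by move=> Aw; exists (X w).
rewrite {1}AE measure_fin_bigcup//.
- rewrite [RHS](fsbig_seq _ _ (index_enum_uniq I)); apply: eq_fsbigl.
  by apply/seteqP; split => // s _ /=; rewrite mem_index_enum.
- exact: finite_finset.
- move=> s t _ _ [w [[_ <-] [_ <-]]] //.
- by move=> s _; apply: measurableI.
Qed.

Lemma ge0_integral_fin_partition d (T : measurableType d) (R : realType)
    (mu : {measure set T -> \bar R}) (I : finType) (X : T -> I) (A : set T)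
    (f : T -> \bar R) :
  measurable A -> (forall s, measurable (X @^-1` [set s])) ->
  measurable_fun setT f -> (forall x, 0 <= f x)%E ->
  (\int[mu]_(w in A) f w = \sum_s \int[mu]_(w in A `&` X @^-1` [set s]) f w)%E.
Proof.
move=> mA mX mf f0.
have AE : A = \big[setU/set0]_(s <- index_enum I) (A `&` X @^-1` [set s]).
  rewrite -bigcup_seq; apply/seteqP; split => w; last by case=> s _ [].
  by move=> Aw; exists (X w) => //=; exact: mem_index_enum.
rewrite {1}AE ge0_integral_bigsetU//.
- by move=> s; exact: measurableI.
- exact: index_enum_uniq.
- by move=> s t _ _ [w [[_ <-] [_ <-]]].
- exact: measurable_funTS.
Qed.

Lemma ge0_integral_mrestr d (T : measurableType d) (R : realType)
    (mu : {measure set T -> \bar R}) (D : set T) (mD : measurable D)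
    (f : T -> \bar R) :
  measurable_fun setT f -> (forall x, 0 <= f x)%E ->
  (\int[mrestr mu mD]_x f x = \int[mu]_(x in D) f x)%E.
Proof.
move=> mf f0.
rewrite [LHS](@ge0_negligible_integral _ _ _ _ _ (~` D))//=.
- rewrite setDE setCK setTI; apply: eq_measure_integral => A mA AD.
  by rewrite /= /mrestr setIidl.
- exact: measurableC.
- by rewrite /mrestr setICl measure0.
Qed.

(** The half-lines $]t,+\infty[$ are closed under intersection, generate the Borel sets and cover
    the line; finite mass gives their measure by complement. *)
Lemma eq_finite_measure_rays (R : realType) (m1 m2 : {measure set R -> \bar R}) :
  (m1 setT < +oo)%E -> m1 setT = m2 setT ->
  (forall t, m1 `]-oo, t] = m2 `]-oo, t]) ->
  forall B, measurable B -> m1 B = m2 B.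
Proof.
move=> m1oo m12 rays B mB.
have gtE (m : {measure set R -> \bar R}) t : (m setT < +oo)%E ->
    (m `]t, +oo[ = m setT - m `]-oo, t])%E.
  by move=> moo; rewrite -setCitvl -setTD measureD// setTI.
apply: (@measure_unique _ _ _ (@RGenOInfty.G R) (fun n => `]- n%:R, +oo[%classic)) => //.
- exact: RGenOInfty.measurableE.
- move=> _ _ [x ->] [y ->]; exists (Num.max x y).
  by apply/seteqP; split=> z /=; rewrite !in_itv/= !andbT gt_max => /andP.
- by move=> n; exists (- n%:R).
- rewrite -subTset => x _; exists (Num.trunc (- x)).+1 => //=.
  by rewrite in_itv/= andbT ltrNl; exact: truncnS_gt.
- by move=> _ [x ->]; rewrite !gtE// -?m12// rays.
- move=> n; apply: le_lt_trans m1oo; apply: le_measure; rewrite ?inE//.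
Qed.

Section RestrictedLaw.
Context d (T : measurableType d) (R : realType) (mu : {measure set T -> \bar R})
  (D : set T) (X : T -> R) (nu : {measure set R -> \bar R}) (c : {nonneg R}).
Hypotheses (mD : measurable D) (mX : measurable_fun setT X).
Hypotheses (muD_fin : (mu D < +oo)%E) (muD : mu D = (c%:num%:E * nu setT)%E).

Lemma restricted_law_rays :
  (forall t, mu (D `&` X @^-1` `]-oo, t]) = c%:num%:E * nu `]-oo, t])%E ->
  forall B, measurable B -> mu (D `&` X @^-1` B) = (c%:num%:E * nu B)%E.
Proof.
move=> rays B mB.
pose m1 := measure_function_pushforward__canonical__measure_function_Measure
  (mrestr mu mD) mX.
have m1E A : m1 A = mu (D `&` X @^-1` A) by rewrite setIC.
rewrite -m1E; apply: (eq_finite_measure_rays (m2 := mscale c nu)) => //.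
- by rewrite m1E preimage_setT setIT.
- by rewrite m1E preimage_setT setIT.
- by move=> t; rewrite m1E rays.
Qed.

Lemma ge0_integral_restricted_law (f : R -> \bar R) :
  (forall B, measurable B -> mu (D `&` X @^-1` B) = c%:num%:E * nu B)%E ->
  measurable_fun setT f -> (forall x, 0 <= f x)%E ->
  (\int[mu]_(w in D) f (X w) = c%:num%:E * \int[nu]_x f x)%E.
Proof.
move=> law mf f0.
rewrite -(ge0_integral_mrestr mu mD)//; last exact: measurableT_comp.
have := ge0_integral_pushforward mX (mrestr mu mD) measurableT mf (fun x _ => f0 x).
rewrite preimage_setT /comp => <-.
rewrite -ge0_integral_mscale//.
apply: (@eq_measure_integral _ _ _ _ _
  (measure_function_pushforward__canonical__measure_function_Measure _ mX)) => B mB _.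
by rewrite /= /pushforward /mrestr setIC law.
Qed.

End RestrictedLaw.

End MeasureComplements.

(** * The return time of a semi-Markov process *)

Section SemiMarkov.
Context (R : realType) (N : nat) (Q : 'I_N -> 'I_N -> {measure set R -> \bar R})
  (i : 'I_N) d (Omega : measurableType d) (P : probability Omega R)
  (eta : nat -> Omega -> 'I_N) (kappa : nat -> Omega -> R).
Hypotheses (Q_reg : sm_kernel_regular Q)
  (sm : is_semi_markov_from Q i P eta kappa).

Lemma kernel_finite k j : (Q k j setT < +oo)%E.
Proof. by case: Q_reg => _ []. Qed.

Lemma kernel_fin_num k j (A : set R) : measurable A -> Q k j A \is a fin_num.
Proof.
move=> mA; rewrite ge0_fin_numE//; apply: le_lt_trans (kernel_finite k j).
by apply: le_measure; rewrite ?inE.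
Qed.

Lemma trans_probE k j : Q k j setT = (trans_prob (Q k j))%:E.
Proof. by rewrite /trans_prob fineK// kernel_fin_num. Qed.

Lemma measurable_eta n j : measurable (eta n @^-1` [set j]).
Proof. by case: sm. Qed.

Lemma measurable_kappa n : measurable_fun setT (kappa n).
Proof. by case: sm => _ []. Qed.

Lemma measurable_kappa_preimage n (B : set R) : measurable B -> measurable (kappa n @^-1` B).
Proof. by move=> mB; rewrite -[X in measurable X]setTI; exact: measurable_kappa. Qed.

(** * Finite paths with bounds on the sojourn times *)

Definition ray (c : option R) : set R :=
  if c is Some t then `]-oo, t] else setT.

Lemma measurable_ray c : measurable (ray c).
Proof. by case: c => [t|] /=. Qed.

(** Finite bounds whose half-lines increase to [ray c]; an absent bound is approached by the
    integers. *)
Let bound (c : option R) (M : nat) : R := if c is Some t then t else M%:R.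

Let bound_le c M M' : (M <= M')%N -> bound c M <= bound c M'.
Proof. by case: c => [t|] //= MM'; rewrite ler_nat. Qed.

Let rayP c x : ray c x <-> exists M, x <= bound c M.
Proof.
case: c => [t|] /=; rewrite ?in_itv/=; first by split=> [|[]//]; exists 0%N.
by split=> // _; exists (Num.trunc x).+1; rewrite ltW// truncnS_gt.
Qed.

Let ray_bound (mu : {measure set R -> \bar R}) c :
  mu `]-oo, bound c M] @[M --> \oo] --> mu (ray c).
Proof.
have -> : ray c = \bigcup_M `]-oo, bound c M]%classic.
  apply/seteqP; split=> x; first by move=> /rayP[M xM]; exists M => //=; rewrite in_itv.
  by move=> [M _] /=; rewrite in_itv/= => xM; apply/rayP; exists M.
apply: nondecreasing_cvg_mu => //; first exact: bigcup_measurable.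
move=> M M' MM'; apply/subsetPset => x /=; rewrite !in_itv/= => /le_trans; apply.
exact: bound_le.
Qed.

(* [c k] bounds [kappa k.+1]; [None] leaves it free. *)
Definition path_event n (l : nat -> 'I_N) (c : nat -> option R) : set Omega :=
  [set w | eta 0 w = l 0%N /\ forall k, (k < n)%N ->
    eta k.+1 w = l k.+1 /\ ray (c k) (kappa k.+1 w)].

Lemma measurable_path_event n l c : measurable (path_event n l c).
Proof.
rewrite (_ : path_event n l c = eta 0 @^-1` [set l 0%N] `&`
    \big[setI/setT]_(k < n) (eta k.+1 @^-1` [set l k.+1] `&` kappa k.+1 @^-1` ray (c k))).
  apply: measurableI; first exact: measurable_eta.
  apply: bigsetI_measurable => k _; apply: measurableI; first exact: measurable_eta.
  by apply: measurable_kappa_preimage; exact: measurable_ray.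
rewrite -(bigcap_mkord n (fun k =>
  eta k.+1 @^-1` [set l k.+1] `&` kappa k.+1 @^-1` ray (c k))).
by apply/seteqP; split => w [w0 wk]; split => // k /= kn; have [] := wk k kn.
Qed.

(** For finite bounds this is the defining formula of the process; absent bounds follow by
    continuity from below as [M] grows. *)
Lemma path_event_prob n l c : P (path_event n l c) =
  ((l 0%N == i)%:R * \prod_(k < n) fine (Q (l k) (l k.+1) (ray (c k))))%:E.
Proof.
pose F M := [set w | eta 0 w = l 0%N /\ forall k, (k < n)%N ->
  eta k.+1 w = l k.+1 /\ kappa k.+1 w <= bound (c k) M].
have FE M : F M = path_event n l (fun k => Some (bound (c k) M)).
  by apply/seteqP; split=> w [w0 wk]; split.
have PF M : P (F M) = ((l 0%N == i)%:R *
    \prod_(k < n) fine (Q (l k) (l k.+1) `]-oo, bound (c k) M]%classic))%:E.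
  (* The bound on [kappa k.+1] has index [k] in [c] but [k.+1] in the definition of the process,
     whence [k.-1]. *)
  case: sm => _ [_ /(_ n l (fun k => bound (c k.-1) M)) ->].
  rewrite EFinM -prodEFin; congr (_ * _)%E; apply: eq_bigr => k _.
  by rewrite fineK// kernel_fin_num.
have UF : path_event n l c = \bigcup_M F M.
  apply/seteqP; split => w; last first.
    move=> [M _ [w0 wk]]; split=> // k kn; have [? ?] := wk k kn; split=> //.
    by apply/rayP; exists M.
  move=> [w0 wk].
  (* Only finitely many times are constrained, so one [M] serves them all. *)
  have [M HM] : exists M, forall k, (k < n)%N -> kappa k.+1 w <= bound (c k) M.
    elim: {F FE PF} n wk => [|m IH] wk; first by exists 0%N.
    have [k km|M HM] := IH; first by apply: wk; exact: ltnW.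
    have [_ /rayP[M' HM']] := wk m (ltnSn m).
    exists (maxn M M') => k; rewrite ltnS leq_eqVlt => /orP[/eqP->|km].
      by apply: le_trans HM' _; apply: bound_le; rewrite leq_maxr.
    by apply: le_trans (HM k km) _; apply: bound_le; rewrite leq_maxl.
  by exists M => //; split=> // k kn; have [? _] := wk k kn; split => //; exact: HM.
have cvg1 : P (F M) @[M --> \oo] --> P (path_event n l c).
  rewrite UF; apply: nondecreasing_cvg_mu.
  - by move=> M; rewrite FE; exact: measurable_path_event.
  - by rewrite -UF; exact: measurable_path_event.
  - move=> M M' MM'; apply/subsetPset => w [w0 wk]; split=> // k kn.
    have [? h] := wk k kn; split=> //; apply: le_trans h _; exact: bound_le.
apply: (cvg_unique _ cvg1) => //; rewrite (funext PF).
apply: cvg_EFin; first exact: nearW.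
apply: cvgM; first exact: cvg_cst.
apply: cvg_big => [x y|k _]; first exact: mul_continuous.
apply: fine_cvg; rewrite fineK; first exact: ray_bound.
by apply: kernel_fin_num; exact: measurable_ray.
Qed.

(** * One-step law and Markov property *)

Let past n (l : nat -> 'I_N) : set Omega := path_event n l (fun=> None).

Let pastP n l w : past n l w <-> forall k, (k <= n)%N -> eta k w = l k.
Proof.
split; last by move=> h; split=> [|k kn]; [exact: h|split=> //; exact: h].
by move=> [w0 wk] [|k] kn //; have [] := wk k kn.
Qed.

Let past_fin n l : P (past n l) \is a fin_num.
Proof. by rewrite fin_num_measure//; exact: measurable_path_event. Qed.

(** For [B] a half-line or the whole line, both sides follow from the path probabilities; the
    equality then extends to Borel sets. *)
Lemma one_step_law n l B : measurable B ->
  P (past n.+1 l `&` kappa n.+1 @^-1` B) = (P (past n l) * Q (l n) (l n.+1) B)%E.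
Proof.
have step c : P (past n.+1 l `&` kappa n.+1 @^-1` ray c) =
    (P (past n l) * Q (l n) (l n.+1) (ray c))%E.
  have -> : past n.+1 l `&` kappa n.+1 @^-1` ray c =
      path_event n.+1 l (fun k => if k == n then c else None).
    apply/seteqP; split => w.
      move=> [[w0 wk] wc]; split=> // k kn; have [wkk _] := wk k kn; split=> //.
      by case: eqP => [->|].
    move=> [w0 wk]; split; last by have [] := wk n (ltnSn n); rewrite eqxx.
    by split=> // k kn; have [] := wk k kn.
  rewrite !path_event_prob big_ord_recr/= eqxx mulrA EFinM fineK; last first.
    by apply: kernel_fin_num; exact: measurable_ray.
  by under eq_bigr => k _ do rewrite ltn_eqF//.
move=> mB; have step0 := step None; rewrite /= preimage_setT setIT in step0.
have c0 : 0 <= fine (P (past n l)) by rewrite fine_ge0.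
rewrite -(fineK (past_fin n l)) in step0 step *.
apply: (@restricted_law_rays _ _ _ _ _ _ _ (NngNum c0)) => //.
- exact: measurable_path_event.
- exact: measurable_kappa.
- by rewrite ltey_eq fin_num_measure//; exact: measurable_path_event.
- by move=> t; exact: (step (Some t)).
Qed.

(** The states up to time [n] form a vector with finitely many values, so every event about them is
    a finite disjoint union of [past] events. *)
Let hist n (w : Omega) : {ffun 'I_n.+1 -> 'I_N} := [ffun m : 'I_n.+1 => eta m w].

Let hist_past n s : hist n @^-1` [set s] = past n (fun m => s (inord m)).
Proof.
apply/seteqP; split => w.
  by move=> <-; apply/pastP => k kn; rewrite ffunE inordK.
move=> /pastP h; apply/ffunP => m; rewrite ffunE h -1?ltnS//.
by rewrite inord_val.
Qed.

Let measurable_hist n s : measurable (hist n @^-1` [set s]).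
Proof. by rewrite hist_past; exact: measurable_path_event. Qed.

Let measurable_hist_pred n (a : pred {ffun 'I_n.+1 -> 'I_N}) :
  measurable [set w | a (hist n w)].
Proof.
rewrite (_ : [set w | _] = \bigcup_(s in [set s | a s]) hist n @^-1` [set s]).
  by apply: fin_bigcup_measurable => //; exact: finite_finset.
apply/seteqP; split => w /=; first by move=> aw; exists (hist n w).
by move=> [s sa /= ->].
Qed.

(** The one-step law is summed over the histories compatible with [a] and with $\eta_n = k$; the
    others contribute empty sets on both sides. *)
Lemma markov_property n (a : pred {ffun 'I_n.+1 -> 'I_N}) k j B : measurable B ->
  P ([set w | a (hist n w)] `&` eta n @^-1` [set k] `&`
     (eta n.+1 @^-1` [set j] `&` kappa n.+1 @^-1` B)) =
  (P ([set w | a (hist n w)] `&` eta n @^-1` [set k]) * Q k j B)%E.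
Proof.
move=> mB.
have mA : measurable ([set w | a (hist n w)] `&` eta n @^-1` [set k]).
  by apply: measurableI; [exact: measurable_hist_pred|exact: measurable_eta].
rewrite (measure_fin_partition P _ (@measurable_hist n)); last first.
  apply: measurableI => //; apply: measurableI; first exact: measurable_eta.
  exact: measurable_kappa_preimage.
rewrite [in RHS](measure_fin_partition P mA (@measurable_hist n)).
rewrite ge0_sume_distrl//; apply: eq_bigr => s _.
have [/andP[sa /eqP sk]|bad] := boolP (a s && (s ord_max == k)); last first.
  rewrite (_ : [set w | a (hist n w)] `&` eta n @^-1` [set k] `&`
     hist n @^-1` [set s] = set0).
    rewrite measure0 mul0e -(measure0 P); congr (P _); rewrite -subset0.
    move=> w [[[/= wa wk] _] ws]; apply: (negP bad); rewrite -ws wa ffunE.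
    exact/eqP.
  rewrite -subset0 => w [[/= wa wk] ws]; apply: (negP bad); rewrite -ws wa ffunE.
  exact/eqP.
pose l m := if (m <= n)%N then s (inord m) else j.
have past_l : past n l = hist n @^-1` [set s].
  rewrite hist_past; apply/seteqP; split => w /pastP h; apply/pastP => m mn;
    by rewrite h// /l mn.
have ln : l n = k by rewrite /l leqnn -sk; congr (s _); apply/val_inj; rewrite /= inordK.
have ln1 : l n.+1 = j by rewrite /l ltnn.
have pastS w : past n.+1 l w <-> past n l w /\ eta n.+1 w = j.
  split=> [/pastP h|[/pastP h hj]].
    by split; [apply/pastP => m mn; rewrite h// leqW|rewrite h].
  by apply/pastP => m; rewrite leq_eqVlt => /orP[/eqP ->|]; [rewrite ln1|rewrite ltnS => /h].
have good w : past n l w -> a (hist n w) /\ eta n w = k.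
  move=> h; have /pastP/(_ n (leqnn n)) := h; rewrite ln; split=> //.
  by move: h; rewrite past_l => /= ->.
transitivity (P (past n.+1 l `&` kappa n.+1 @^-1` B)).
  congr (P _); apply/seteqP; split => w.
    move=> [[_ [wj wB]] ws]; split=> //; apply/pastS; split=> //.
    by rewrite past_l.
  move=> [/pastS[wl wj] wB]; have [? ?] := good w wl.
  by rewrite past_l in wl.
rewrite one_step_law// ln ln1; congr (P _ * _)%E.
rewrite -past_l; apply/seteqP; split => w; last by case.
by move=> wl; split=> //; exact: good.
Qed.

(** * Taboo probabilities before the return to [i] *)

Let no_return n : set Omega := [set w | forall m, (0 < m <= n)%N -> eta m w != i].

Let no_return_hist n : no_return n =
  [set w | [pred s : {ffun 'I_n.+1 -> 'I_N} |
     [forall m : 'I_n.+1, (0 < m)%N ==> (s m != i)]] (hist n w)].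
Proof.
apply/seteqP; split => w /=.
  move=> h; apply/forallP => m; apply/implyP => m0; rewrite ffunE h// m0.
  by rewrite -ltnS ltn_ord.
move=> /forallP h m /andP[m0 mn].
by have := h (Ordinal (mn : (m < n.+1)%N)); rewrite /= m0 ffunE.
Qed.

Let measurable_no_return n : measurable (no_return n).
Proof. by rewrite no_return_hist; exact: measurable_hist_pred. Qed.

Let measurable_no_return_at n k : measurable (no_return n `&` eta n @^-1` [set k]).
Proof. by apply: measurableI => //; exact: measurable_eta. Qed.

(** The taboo probabilities $P(\nu > n, \eta_n = k)$; time $0$ is not tested by [no_return], so they
    start from the unit mass at [i]. *)
Let occ n k : R := fine (P (no_return n `&` eta n @^-1` [set k])).

Let occE n k : P (no_return n `&` eta n @^-1` [set k]) = (occ n k)%:E.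
Proof. by rewrite fineK// fin_num_measure. Qed.

Let occ_ge0 n k : 0 <= occ n k. Proof. exact: fine_ge0. Qed.

Let no_return_step n k j B : measurable B ->
  P (no_return n `&` eta n @^-1` [set k] `&`
    (eta n.+1 @^-1` [set j] `&` kappa n.+1 @^-1` B)) = ((occ n k)%:E * Q k j B)%E.
Proof. by move=> mB; rewrite -occE no_return_hist markov_property. Qed.

Let occ0 k : occ 0 k = (k == i)%:R.
Proof.
have := path_event_prob 0 (fun=> k) (fun=> None).
rewrite big_ord0 mulr1 /occ => PE.
rewrite (_ : _ `&` _ = path_event 0 (fun=> k) (fun=> None)) ?PE//.
apply/seteqP; split => w; first by move=> [_ wk]; split.
by move=> [wk _]; split=> // -[|m].
Qed.

(** Being at [i] at time $n+1$ contradicts $\nu > n+1$; elsewhere the Markov property is summed over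
    the state at time [n]. *)
Let occS n j : occ n.+1 j =
  if j == i then 0 else \sum_k occ n k * trans_prob (Q k j).
Proof.
case: (eqVneq j i) => [->|ji].
  rewrite /occ (_ : _ `&` _ = set0) ?measure0// -subset0 => w [h wi].
  by have := h n.+1; rewrite leqnn wi eqxx => /(_ isT).
apply: EFin_inj; rewrite -occE.
rewrite (measure_fin_partition P _ (@measurable_eta n))// -sumEFin.
apply: eq_bigr => k _.
rewrite EFinM -trans_probE -no_return_step// preimage_setT setIT; congr (P _).
apply/seteqP; split => w.
  move=> [[h wj] wk]; split=> //; split=> // m /andP[m0 mn].
  by apply: h; rewrite m0 leqW.
move=> [[h wk] wj]; split=> //; split=> // m /andP[m0].
rewrite leq_eqVlt => /orP[/eqP ->|]; first by rewrite wj.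
by rewrite ltnS => mn; apply: h; rewrite m0.
Qed.

Let surv n : R := \sum_k occ n k.

Let survE n : P (no_return n) = (surv n)%:E.
Proof.
rewrite (measure_fin_partition P _ (@measurable_eta n))// -sumEFin.
by apply: eq_bigr => k _; exact: occE.
Qed.

(** * Sojourn times before the return *)

Let kappa_ge0_ae n : P (kappa n.+1 @^-1` `]-oo, 0[) = 0%E.
Proof.
have mk : measurable (kappa n.+1 @^-1` `]-oo, 0%R[).
  exact: measurable_kappa_preimage.
rewrite (measure_fin_partition P mk (@measurable_eta n)).
rewrite big1// => k _.
rewrite (measure_fin_partition P _ (@measurable_eta n.+1)); last first.
  by apply: measurableI => //; exact: measurable_eta.
rewrite big1// => j _.
have := markov_property (n := n) predT k j (measurable_itv `]-oo, (0 : R)[%R).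
case: Q_reg => -> _; rewrite mule0 => <-; congr (P _).
by apply/seteqP; split => w; [move=> [[? ?] ?]|move=> [[_ ?] [? ?]]].
Qed.

(** Sojourn times are nonnegative only almost surely. The positive part makes them nonnegative
    everywhere and alters them on a null set only. *)
Let pos (t : R) : \bar R := (Num.max t 0)%:E.

Let pos_ge0 t : (0 <= pos t)%E.
Proof. by rewrite lee_fin le_max lexx orbT. Qed.

Let measurable_pos : measurable_fun setT pos.
Proof. by apply/measurable_EFinP; exact: measurable_maxr. Qed.

Let mean_time_pos k j : (\int[Q k j]_t pos t)%E = (mean_time (Q k j))%:E.
Proof.
have [Qneg [_ [_ [_ Qint]]]] := Q_reg.
rewrite /mean_time fineK; last exact: integrable_fin_num.
apply: ae_eq_integral => //.
exists `]-oo, 0%R[%classic; split=> // t /= /not_implyP[_].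
rewrite in_itv/= /pos ltNge => h; apply/negP => t0; apply: h.
by rewrite (max_l t0).
Qed.

Let measurable_pos_kappa n : measurable_fun setT (fun w => pos (kappa n w)).
Proof. by apply: measurableT_comp => //; exact: measurable_kappa. Qed.

(** On $\{\nu > n, \eta_n = k, \eta_{n+1} = j\}$ the law of $\kappa_{n+1}$ is [occ n k] times
    $Q_{kj}$. *)
Let integral_no_return n : (\int[P]_(w in no_return n) pos (kappa n.+1 w))%E =
  (\sum_k occ n k * \sum_j mean_time (Q k j))%:E.
Proof.
rewrite (ge0_integral_fin_partition P _ (@measurable_eta n))// -sumEFin.
apply: eq_bigr => k _.
rewrite (ge0_integral_fin_partition P _ (@measurable_eta n.+1))//.
rewrite mulr_sumr -sumEFin; apply: eq_bigr => j _.
have step B : measurable B ->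
    P (no_return n `&` eta n @^-1` [set k] `&` eta n.+1 @^-1` [set j] `&`
       kappa n.+1 @^-1` B) = ((occ n k)%:E * Q k j B)%E.
  by move=> mB; rewrite -setIA no_return_step.
rewrite (ge0_integral_restricted_law (nu := Q k j) (c := NngNum (occ_ge0 n k)) _ _ step)//.
- by rewrite mean_time_pos.
- by apply: measurableI => //; exact: measurable_eta.
- exact: measurable_kappa.
Qed.

(** * Telescoping along solutions of the hitting system *)

Let hitting_system (z f : 'I_N -> R) := forall k,
  0 <= z k /\ z k = f k + \sum_(j | j != i) trans_prob (Q k j) * z j.

(** The omission of $j = i$ in the system matches the vanishing of [occ n.+1 i], so the sum of
    [occ n k * z k] passes from [n] to [n.+1] at the cost of the [f] term. *)
Let telescope_occ z f M : hitting_system z f ->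
  \sum_(n < M) \sum_k occ n k * f k = z i - \sum_k occ M k * z k.
Proof.
move=> zf; elim: M => [|M IH].
  rewrite big_ord0 (bigD1 i)//= occ0 eqxx mul1r big1 ?addr0 ?subrr// => k ki.
  by rewrite occ0 (negbTE ki) mul0r.
rewrite big_ord_recr/= IH.
suff -> : \sum_k occ M k * z k = \sum_k occ M k * f k + \sum_k occ M.+1 k * z k by ring.
under eq_bigr => k _ do rewrite {1}(proj2 (zf k)) mulrDr.
rewrite big_split/=; congr (_ + _).
under eq_bigr => k _ do rewrite mulr_sumr.
rewrite exchange_big/= [RHS](bigD1 i)//= occS eqxx mul0r add0r.
apply: eq_bigr => j ji; rewrite occS (negbTE ji) mulr_suml.
by apply: eq_bigr => k _; rewrite mulrA.
Qed.

(** * Return time as a sum over no-return events *)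

Let return_time_never w : (\bigcap_n no_return n) w -> return_time eta kappa i w = +oo%E.
Proof.
move=> h; rewrite /return_time; case: pselect => // e.
exfalso; case: e => n /= /andP[n0 /eqP wn].
have /eqP[] : eta n w != i by apply: (h n I); rewrite n0 leqnn.
exact: wn.
Qed.

Let return_time_at n w : no_return n w -> eta n.+1 w = i ->
  return_time eta kappa i w = (\sum_(k < n.+1) kappa k.+1 w)%:E.
Proof.
move=> h wi; rewrite /return_time; case: pselect => [e|[]]; last first.
  by exists n.+1 => /=; rewrite wi eqxx.
case: ex_minnP => m /andP[m0 /eqP wm] mmin.
suff -> : m = n.+1 by [].
apply/eqP; rewrite eqn_leq mmin /=; last by rewrite wi eqxx.
rewrite leqNgt ltnS; apply/negP => mn.
have /eqP[] : eta m w != i by apply: h; rewrite m0.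
exact: wm.
Qed.

Let first_return_cover w : (\bigcap_n no_return n) w \/
  exists n, no_return n w /\ eta n.+1 w = i.
Proof.
have [e|ne] := pselect (exists n, (0 < n)%N && (eta n w == i)); last first.
  left=> n _ m /andP[m0 _]; apply/negP => wi; apply: ne; exists m.
  by rewrite m0.
right; case: (ex_minnP e) => -[//|n] /= /eqP wn nmin; exists n; split=> //.
move=> m /andP[m0 mn]; apply/negP => wm; have : (n < m)%N by apply: nmin; rewrite m0.
by rewrite ltnNge mn.
Qed.

Let measurable_return_time : measurable_fun setT (return_time eta kappa i).
Proof.
(* A countable cover on whose members the return time is infinite or a finite sum: index $0$ for no
   return, index $m+1$ for a first return at $m+1$. *)
pose E n := if n is m.+1 then no_return m `&` eta m.+1 @^-1` [set i]
            else \bigcap_n no_return n.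
have mE n : measurable (E n).
  case: n => [|n] /=; first exact: bigcapT_measurable.
  by apply: measurableI => //; exact: measurable_eta.
rewrite (_ : setT = \bigcup_n E n); last first.
  apply/esym; rewrite -subTset => w _.
  by have [h|[n h]] := first_return_cover w; [exists 0%N|exists n.+1].
apply/(measurable_fun_bigcup _ mE) => -[|n].
  apply: (eq_measurable_fun (cst +oo%E)) => // w.
  by rewrite inE => h; rewrite return_time_never.
apply: (eq_measurable_fun (fun w => (\sum_(k < n.+1) kappa k.+1 w)%:E)).
  by move=> w; rewrite inE => -[h wi]; rewrite (return_time_at h wi).
apply/measurable_EFinP; apply: measurable_funTS; apply: measurable_sum => k.
exact: measurable_kappa.
Qed.

(** If the first return is at $n+1$, exactly the terms of index at most [n] survive, and they are
    the sojourn times that make up the return time. *)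
Let return_time_series w : ~ (\bigcap_n no_return n) w ->
  (forall n, 0 <= kappa n.+1 w) ->
  return_time eta kappa i w =
  (\sum_(n <oo) ((fun w => pos (kappa n.+1 w)) \_ (no_return n)) w)%E.
Proof.
move=> hw k0; have [//|[n [nw wi]]] := first_return_cover w.
rewrite (return_time_at nw wi) (nneseries_split 0 n.+1); last first.
  by move=> k _; rewrite patchE; case: ifP.
rewrite [X in (_ + X)%E]eseries0 ?adde0; last first.
  move=> k; rewrite add0n => nk _; rewrite patchE ifF//.
  apply/negbTE; rewrite notin_setE => h.
  have /eqP[] : eta n.+1 w != i by apply: h; rewrite nk.
  exact: wi.
rewrite add0n big_mkord -sumEFin; apply: eq_bigr => k _.
rewrite patchE ifT; first by rewrite /pos max_l.
rewrite inE => m /andP[m0 mk]; apply: nw; rewrite m0 (leq_trans mk)//.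
by rewrite -ltnS ltn_ord.
Qed.

Lemma return_time_integral (x y : 'I_N -> R) :
  (forall k, 0 <= x k /\ x k = \sum_j mean_time (Q k j) +
     \sum_(j | j != i) trans_prob (Q k j) * x j) ->
  (forall k, 0 <= y k /\ y k = 1 + \sum_(j | j != i) trans_prob (Q k j) * y j) ->
  (\int[P]_w return_time eta kappa i w = (x i)%:E)%E.
Proof.
move=> hx hy.
have surv_ge0 n : 0 <= surv n by apply: sumr_ge0.
(* [y] bounds the partial sums of [surv], so that a return is almost sure. *)
have surv0 : surv n @[n --> \oo] --> 0.
  apply: cvg_series_cvg_0; apply: nondecreasing_is_cvgn.
    by apply: nondecreasing_series => n _ _; exact: surv_ge0.
  exists (y i) => _ [M _ <-]; rewrite /series/= big_mkord.
  have := telescope_occ M hy.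
  under eq_bigr => n _ do under eq_bigr => k _ do rewrite mulr1.
  move=> ->; rewrite gerBl sumr_ge0// => k _.
  by rewrite mulr_ge0//; case: (hy k).
have partial_cvg : (\sum_(n < M) \sum_k occ n k * \sum_j mean_time (Q k j))
    @[M --> \oo] --> x i.
  under eq_fun => M do rewrite (telescope_occ M hx).
  suff : \sum_k occ M k * x k @[M --> \oo] --> 0.
    by move=> /(cvgB (cvg_cst (x i))); rewrite subr0.
  (* The rest at time [M] is at most $P(\nu > M)$ times the sum of all $x_k$. *)
  apply: (@squeeze_cvgr _ _ _ _ (fun=> 0) (fun M => surv M * \sum_k x k)).
  - apply: nearW => M; apply/andP; split.
      by apply: sumr_ge0 => k _; rewrite mulr_ge0//; case: (hx k).
    rewrite mulr_suml; apply: ler_sum => k _; apply: ler_wpM2l => //.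
    rewrite (bigD1 k)//= lerDl; apply: sumr_ge0 => j _; by case: (hx j).
  - exact: cvg_cst.
  - by have := cvgM surv0 (cvg_cst (\sum_k x k)); rewrite mul0r; apply.
have never0 : P (\bigcap_n no_return n) = 0%E.
  have mI : measurable (\bigcap_n no_return n) by exact: bigcapT_measurable.
  rewrite -[LHS]fineK ?fin_num_measure//; congr EFin.
  apply/eqP; rewrite eq_le fine_ge0// andbT.
  apply: (cvgr_to_ge surv0); apply: nearW => n.
  rewrite -lee_fin fineK ?fin_num_measure// -survE; apply: le_measure; rewrite ?inE//.
  by move=> w; apply.
pose g n := (fun w => pos (kappa n.+1 w)) \_ (no_return n).
have g_ge0 n w : (0 <= g n w)%E by rewrite /g patchE; case: ifP.
have mg n : measurable_fun setT (g n).
  apply: (iffLR (measurable_restrictT _ (measurable_no_return n))).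
  exact: measurable_funTS.
transitivity (\int[P]_w \sum_(n <oo) g n w)%E.
  apply: ae_eq_integral => //.
    by apply: ge0_emeasurable_sum.
  (* The two integrands can differ only if there is no return or some sojourn time is negative. *)
  have neg : P.-negligible
      (\bigcap_n no_return n `|` \bigcup_n kappa n.+1 @^-1` `]-oo, 0[).
    apply: negligibleU.
      by apply/negligibleP => //; exact: bigcapT_measurable.
    apply: negligible_bigcup => n; apply/negligibleP; last exact: kappa_ge0_ae.
    exact: measurable_kappa_preimage.
  apply: negligibleS neg => w /= /not_implyP[_ hw].
  apply: contrapT => /not_orP[h1 h2]; apply: hw.
  apply: return_time_series => // n; rewrite leNgt; apply/negP => kn.
  by apply: h2; exists n => //=; rewrite in_itv.
rewrite integral_nneseries//; apply/cvg_lim => //.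
rewrite (_ : (fun n => _) =
  EFin \o (fun M => \sum_(n < M) \sum_k occ n k * \sum_j mean_time (Q k j))).
  by apply: cvg_EFin => //; exact: nearW.
apply/funext => M /=; rewrite big_mkord -sumEFin; apply: eq_bigr => n _.
by rewrite -integral_no_return [RHS]integral_mkcond.
Qed.

End SemiMarkov.

(** * Transitions of probability zero *)

Section MeanTime.
Variable R : realType.

(** A measure of total mass zero is zero. This settles the pairs with $j \notin Y_k$, where no
    expansion of the mean is assumed. *)
Lemma mean_time_trans_prob0 (mu : {measure set R -> \bar R}) :
  (mu setT < +oo)%E -> trans_prob mu = 0 -> mean_time mu = 0.
Proof.
move=> mu_fin; rewrite /trans_prob => mu0.
have muT : mu setT = 0%E by rewrite -[LHS]fineK ?mu0// ge0_fin_numE.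
rewrite /mean_time (eq_measure_integral mzero) ?integral_measure_zero//.
by move=> A mA _; exact: (subset_measure0 mA measurableT _ muT).
Qed.

End MeanTime.

(** * Expansion of the expected return time *)

Theorem theorem3 (R : realType) (N : nat) (eps0 : R)
  (Q : R -> 'I_N -> 'I_N -> {measure set R -> \bar R})
  (Y : 'I_N -> {set 'I_N})
  (* coefficients of condition D' *)
  (a : 'I_N -> 'I_N -> nat -> R) (lm lp : 'I_N -> 'I_N -> nat)
  (G delta epsD : 'I_N -> 'I_N -> R)
  (* coefficients of condition E' *)
  (b : 'I_N -> 'I_N -> int -> R) (mm mp : 'I_N -> 'I_N -> int)
  (Gd deltad epsE : 'I_N -> 'I_N -> R) :
  0 < eps0 -> eps0 <= 1 ->
  (* standing regularity conditions *)
  (forall e, 0 < e <= eps0 -> sm_kernel_regular (Q e)) ->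
  (* condition A *)
  (forall i, (0 < #|Y i|)%N) ->
  (forall e i j, 0 < e <= eps0 -> j \in Y i -> 0 < trans_prob (Q e i j)) ->
  (forall e i j, 0 < e <= eps0 -> j \notin Y i -> trans_prob (Q e i j) = 0) ->
  (forall i j, exists n : nat, (1 <= n)%N /\ exists l : nat -> 'I_N,
      l 0%N = i /\ l n = j /\ forall m, (0 < m <= n)%N -> l m \in Y (l m.-1)) ->
  (* condition D' *)
  (forall i j, j \in Y i ->
     [/\ (lm i j <= lp i j)%N, 0 < a i j (lm i j),
         0 < delta i j <= 1, 0 < G i j & 0 < epsD i j <= eps0]) ->
  (forall i j e, j \in Y i -> 0 < e <= epsD i j ->
     `|trans_prob (Q e i j) - poly_exp (a i j) (lm i j) (lp i j) e|
       <= G i j * e `^ ((lp i j)%:R + delta i j)) ->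
  (* condition E' *)
  (forall i j, j \in Y i ->
     [/\ mm i j <= mp i j, 0 < b i j (mm i j),
         0 < deltad i j <= 1, 0 < Gd i j & 0 < epsE i j <= eps0]) ->
  (forall i j e, j \in Y i -> 0 < e <= epsE i j ->
     `|mean_time (Q e i j) - laurent (b i j) (mm i j) (mp i j) e|
       <= Gd i j * e `^ ((mp i j)%:~R + deltad i j)) ->
  let deltastar :=
    \big[Num.min/1]_(i < N) \big[Num.min/1]_(j < N | j \in Y i)
       Num.min (delta i j) (deltad i j) in
  forall i : 'I_N,
  exists (Mm Mp : int) (B : int -> R) (Gs epsii : R),
    [/\ Mm <= Mp, B Mm != 0, 0 < Gs, 0 < epsii <= eps0 &
    forall e, 0 < e <= epsii ->
      forall (d : measure_display) (Omega : measurableType d)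
             (P : probability Omega R)
             (eta : nat -> Omega -> 'I_N) (kappa : nat -> Omega -> R),
      is_semi_markov_from (Q e) i P eta kappa ->
      exists Eii : R,
        (\int[P]_w return_time eta kappa i w)%E = Eii%:E /\
        `|Eii - laurent B Mm Mp e| <= Gs * e `^ (Mp%:~R + deltastar)].
Proof.
move=> eps0_gt0 eps0_le1 reg Y_ne p_gt0 p_eq0 access D_cst D_exp E_cst E_exp.
move=> deltastar i.
have deltastar_gt0 : 0 < deltastar.
  apply: lt_bigmin => // k _; apply: lt_bigmin => // j jk.
  have [_ _ /andP[d0 _] _ _] := D_cst k j jk.
  have [_ _ /andP[d0' _] _ _] := E_cst k j jk.
  by rewrite lt_min d0.
(* The start value $1$ of the iterated minimum gives this bound; it does not alter the minimum, all
   the exponents being at most $1$. *)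
have deltastar_le1 : deltastar <= 1 by exact: bigmin_le_id.
have deltastar_min k j : j \in Y k -> deltastar <= Num.min (delta k j) (deltad k j).
  by move=> jk; apply: (bigmin_inf k) => //; exact: (bigmin_inf j).
have near_dom : \forall e \near 0^'+, 0 < e <= eps0.
  near=> e; apply/andP; split; near: e; first exact: nbhs_right_gt.
  exact: nbhs_right_le.
have p_piv k j : j \in Y k -> pivotal deltastar (fun e => trans_prob (Q e k j)).
  move=> jk; have [llp a0 _ G0 /andP[eD0 _]] := D_cst k j jk.
  have d_le : deltastar <= delta k j.
    by apply: le_trans (deltastar_min k j jk) _; rewrite ge_min lexx.
  apply: (pivotal_laurent (B := a k j \o absz) (m1 := lm k j) (m2 := lp k j)
    deltastar_gt0 deltastar_le1 llp a0 d_le G0 eD0) => e he.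
  by rewrite -poly_exp_laurent//; exact: D_exp.
have p_piv0 k j : pivotal0 deltastar (fun e => trans_prob (Q e k j)).
  have [jk|jk] := boolP (j \in Y k); first by right; exact: p_piv.
  by left; apply: filterS near_dom => e he; exact: p_eq0.
have m_piv k j : j \in Y k -> pivotal deltastar (fun e => mean_time (Q e k j)).
  move=> jk; have [mmp b0 _ Gd0 /andP[eE0 _]] := E_cst k j jk.
  have d_le : deltastar <= deltad k j.
    by apply: le_trans (deltastar_min k j jk) _; rewrite ge_min lexx orbT.
  apply: (pivotal_laurent deltastar_gt0 deltastar_le1 mmp b0 d_le Gd0 eE0) => e he.
  exact: E_exp.
have m_piv0 k j : pivotal0 deltastar (fun e => mean_time (Q e k j)).
  have [jk|jk] := boolP (j \in Y k); first by right; exact: m_piv.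
  left; apply: filterS near_dom => e he; apply: mean_time_trans_prob0.
    exact: (kernel_finite (reg e he)).
  exact: p_eq0.
have access' k : exists n (l : nat -> 'I_N), l 0%N = k /\ l n = i /\
    forall m, (m < n)%N -> l m.+1 \in Y (l m).
  have [n [_ [l [l0 [ln lY]]]]] := access k i; exists n, l; split=> //; split=> //.
  by move=> m mn; exact: (lY m.+1).
have p_sum : \forall e \near 0^'+, forall k, \sum_j trans_prob (Q e k j) = 1.
  by apply: filterS near_dom => e /reg[_ [_ []]].
have m_sum_piv0 k : pivotal0 deltastar (fun e => \sum_j mean_time (Q e k j)).
  exact: (pivotal0_sum deltastar_gt0 deltastar_le1).
(* As [Y i] is nonempty, the right-hand side at [i] has a pivotal term; this excludes a vanishing
   return value. *)
have m_sum_piv : pivotal deltastar (fun e => \sum_j mean_time (Q e i j)).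
  have /card_gt0P[j ji] := Y_ne i.
  exact: (pivotal_sum deltastar_gt0 deltastar_le1
    (f := fun j e => mean_time (Q e i j)) (fun j _ => m_piv0 i j) isT (m_piv i j ji)).
have [x [xi_piv xE]] := pivotal_hitting_system deltastar_gt0 deltastar_le1
  p_piv0 p_piv access' p_sum m_sum_piv0 m_sum_piv.
(* The same system with right-hand side $1$; its solution serves to make $P(\nu > n)$ tend to
   $0$. *)
have one_piv := pivotal_cst deltastar (@ltr01 R).
have [y [_ yE]] := pivotal_hitting_system deltastar_gt0 deltastar_le1
  p_piv0 p_piv access' p_sum (fun=> or_intror one_piv) one_piv.
have [r [/andP[r0 r_eps] rE]] := near_exists_radius eps0_gt0 (filterI xE yE).
have [m [B [C [r' [Bm C0 /andP[r'0 r'r] xB]]]]] := pivotal_laurent_expansion r0 xi_piv.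
exists m, m, B, C, r'; split=> //; first by rewrite r'0 (le_trans r'r).
move=> e he d Omega P eta kappa sm; have /andP[e0 er'] := he.
have e_dom : 0 < e <= eps0 by rewrite e0 (le_trans er') ?(le_trans r'r).
have e_r : 0 < e <= r by rewrite e0 (le_trans er').
have [xe ye] := rE e e_r.
exists (x i e); split; last exact: xB.
exact: (return_time_integral (reg e e_dom) sm (x := x^~ e) (y := y^~ e) xe ye).
Unshelve. all: by end_near. Qed.
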